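(* Equip $\mathbb R$ with Lebesgue measure $\lambda$. Let $1\le q<p\le\infty$, $\alpha=1/q-1/p$, $C(p,q)=(1-q/p)^{1/q}$, and consider the couple $A_0=L^{p,\infty}(dx;L^q(dy))$, $A_1=L^{p,\infty}(dy;L^q(dx))$ of functions $a(x,y)$ on $\mathbb R^2$, with quasi-norms $\|a\|_{A_0}=\big\|x\mapsto\|a(x,\cdot)\|_{L^q}\big\|_{L^{p,\infty}}$ and $\|a\|_{A_1}=\big\|y\mapsto\|a(\cdot,y)\|_{L^q}\big\|_{L^{p,\infty}}$. For $t>0$ let $K_{p,q,t}(a)=\inf\{\|b\|_{A_0}+t\|c\|_{A_1}: a=b+c\}$ and $$|||a|||_{p,q,t}=\sup_{E,F}\big(\lambda(E)^{\alpha}\vee t^{-1}\lambda(F)^{\alpha}\big)^{-1}\Big(\iint_{E\times F}|a(x,y)|^q\,dx\,dy\Big)^{1/q},$$ the supremum over measurable $E,F\subset\mathbb R$ of positive finite measure. Then for any $t>0$ and every $a\in A_0+A_1$, $$C(p,q)\,|||a|||_{p,q,t}\le K_{p,q,t}(a)\le 2\,|||a|||_{p,q,t}.$$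
   Context: Vector-valued spaces are in Bochner's sense. For a nonnegative measurable $g$, $g^*(s)=\inf\{\mu>0:\lambda\{g>\mu\}\le s\}$ and $\|g\|_{L^{p,\infty}}=\sup_{s>0}s^{1/p}g^*(s)$ (the sup norm when $p=\infty$). $u\vee v=\max(u,v)$. *)

(* Defs.v *)
From HB Require Import structures.
From mathcomp Require Import all_boot all_order all_algebra.
From mathcomp Require Import all_classical all_reals all_analysis.
Set Implicit Arguments. Unset Strict Implicit. Unset Printing Implicit Defensive.
Import Order.TTheory GRing.Theory Num.Theory.
Local Open Scope classical_set_scope.
Local Open Scope ring_scope.

Notation RL R := (measurableTypeR R).
Notation leb := (@lebesgue_measure _).

(* 1/p for p in [1, +oo], with the convention 1/oo = 0. *)
Definition einv {R : realType} (p : \bar R) : R :=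
  match p with r%:E => r^-1 | _ => 0 end.

Definition rearr {R : realType} (g : RL R -> \bar R) (s : R) : \bar R :=
  ereal_inf [set (mu%:E : \bar R) | mu in
     [set mu : R | 0 < mu /\ (leb [set x | mu%:E < g x] <= s%:E)%E]].

(* weak-L^p quasi-norm  sup_{s>0} s^{1/p} g^*(s)  (for p = oo: sup_{s>0} g^*(s),
   i.e. the (essential) sup norm). *)
Definition weakLnorm {R : realType} (p : \bar R) (g : RL R -> \bar R) : \bar R :=
  ereal_sup [set ((s `^ einv p)%:E * rearr g s)%E | s in [set s : R | 0 < s]].

Definition normA0 {R : realType} (p : \bar R) (q : R)
    (a : RL R * RL R -> R) : \bar R :=
  weakLnorm p (fun x => Lnorm leb q%:E (EFin \o (fun y => a (x, y)))).

Definition normA1 {R : realType} (p : \bar R) (q : R)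
    (a : RL R * RL R -> R) : \bar R :=
  weakLnorm p (fun y => Lnorm leb q%:E (EFin \o (fun x => a (x, y)))).

Definition Kfun {R : realType} (p : \bar R) (q t : R)
    (a : RL R * RL R -> R) : \bar R :=
  ereal_inf [set (normA0 p q bc.1 + t%:E * normA1 p q bc.2)%E | bc in
    [set bc : (RL R * RL R -> R) * (RL R * RL R -> R) |
       measurable_fun setT bc.1 /\ measurable_fun setT bc.2 /\
       a = bc.1 \+ bc.2]].

Definition alpha {R : realType} (p : \bar R) (q : R) : R := q^-1 - einv p.

Definition Cpq {R : realType} (p : \bar R) (q : R) : R :=
  (1 - q * einv p) `^ q^-1.

Definition tnorm {R : realType} (p : \bar R) (q t : R)
    (a : RL R * RL R -> R) : \bar R :=
  ereal_sup [set (((Num.max (fine (leb EF.1) `^ alpha p q)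
                            (t^-1 * fine (leb EF.2) `^ alpha p q))^-1)%:E *
                  (\int[(leb \x leb)%E]_(z in EF.1 `*` EF.2)
                       ((`|a z| `^ q)%:E)) `^ q^-1)%E
     | EF in [set EF : set (RL R) * set (RL R) |
        measurable EF.1 /\ measurable EF.2 /\
        (0 < leb EF.1 < +oo)%E /\ (0 < leb EF.2 < +oo)%E]].

Definition inA0A1 {R : realType} (p : \bar R) (q : R)
    (a : RL R * RL R -> R) : Prop :=
  exists b c : RL R * RL R -> R,
    [/\ measurable_fun setT b, measurable_fun setT c, a = b \+ c,
        (normA0 p q b < +oo)%E & (normA1 p q c < +oo)%E].

(* Main.v *)
(** Lower bound: if [g] is a function of one variable with
    [lambda {g > N s^(-1/p)} <= s] for all [s > 0], then
    [int_E g^q <= N^q lambda(E)^(1 - q/p) / (1 - q/p)].  Applied to the slice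
    norms of [b] and [c] on a rectangle [E x F], and combined with Minkowski's
    inequality in [L^q(E x F)], this bounds the rectangle norms of [a = b + c].

    Upper bound: normalise [w = |a|^q / N^q] with [N > |||a|||], so that, with
    [beta = 1 - q/p], the mass of [w] on every rectangle [E x F] is at most
    [kap max(lambda(E)^beta, t^-q lambda(F)^beta)] for some [kap < 1].  By Markov's
    inequality, if [F] has measure at most [sg] and [s^beta = t^-q sg^beta], the set
    of [x] whose slice has mass more than [s^(beta - 1)] in [F] has measure at most
    [kap s], and symmetrically in [y].  Along the geometric scales [s_k = r^k],
    [k : int], [kap < r < 1], the gain [kap / r] leaves room to
    iterate these two operations to a common fixed point: decreasing families
    [E_k], [F_k] of measures at most [s_k], [sg_k] that exhaust the line as
    [k -> -oo], such that slices at [x] outside [E_(k+1)] have small mass in [F_k] and slices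
    at [y] outside [F_(k+1)] have small mass in [E_(k+1)].  Restricting [a] to
    [A = U_k (R \ E_(k+1)) x F_k] and to its complement gives [b] and [c] of
    norms at most [N] and [N / t]. *)
Require Import Defs.
From HB Require Import structures.
From mathcomp Require Import all_boot all_order all_algebra.
From mathcomp Require Import all_classical all_reals all_analysis.
From mathcomp Require Import measurable_realfun.
From mathcomp Require Import zify ring lra.
Import Order.TTheory GRing.Theory Num.Theory.
Local Open Scope classical_set_scope.
Local Open Scope ring_scope.

(** * Concavity inequalities for real powers *)

Section PowerInequalities.
Context {R : realType}.
Implicit Types (b g r s x : R).

(** Young's inequality for [x^b] and [1] with conjugate exponents [1/b] and [1/(1-b)]; the
    degenerate case [b = 1] is split off. *)
Lemma powR_le_tangent b x : 0 < b <= 1 -> 0 <= x -> x `^ b <= 1 + b * (x - 1).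
Proof.
move=> /andP[b0 b1] x0; have [->|bn1] := eqVneq b 1; first by rewrite powRr1//; lra.
have g0 : 0 < 1 - b by rewrite subr_gt0 lt_neqAle bn1.
have := @conjugate_powR R (x `^ b) 1 b^-1 (1 - b)^-1 (powR_ge0 _ _) ler01.
rewrite !invr_gt0 !invrK => /(_ b0 g0); rewrite subrKC => /(_ erefl).
rewrite -powRrM mulfV ?gt_eqF// powRr1// powR1 mulr1 mul1r; lra.
Qed.

Lemma powR_subr_ge b s x : 0 < b <= 1 -> 0 < s -> 0 <= x <= s ->
  b * (s - x) * s `^ (b - 1) <= s `^ b - x `^ b.
Proof.
move=> b01 s0 /andP[x0 xs]; have b0 : 0 < b by case/andP: b01.
have xs0 : 0 <= x / s by rewrite divr_ge0// ltW.
have := powR_le_tangent b (x / s) b01 xs0.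
rewrite -(ler_pM2r (powR_gt0 b s0)) -powRM ?(ltW s0)// divfK ?gt_eqF// => h.
rewrite powRB ?(gt_eqF s0) ?implybT// powRr1 ?(ltW s0)//.
have -> : b * (s - x) * (s `^ b / s) = s `^ b - (1 + b * (x / s - 1)) * s `^ b.
  by field; rewrite gt_eqF.
lra.
Qed.

End PowerInequalities.

(** * Weak-type bounds and integrals over sets of finite measure *)

Section WeakType.
Context d (T : measurableType d) (R : realType).
Implicit Types (E : set T) (f : T -> \bar R) (b s k c m : R).
Local Open Scope ereal_scope.

Lemma measurable_superlevel f (c : \bar R) :
  measurable_fun setT f -> measurable [set x | c < f x].
Proof.
by move=> mf; rewrite -[X in measurable X]setTI; exact: emeasurable_fun_o_infty.
Qed.

(** Markov's inequality on a piece of the superlevel set, of measure [e], gives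
    [s^(b-1) e <= k max(e^b, s^b)]; for [e <= s] this reads [e <= k s]. The pieces come from a
    sigma-finite exhaustion, as the superlevel set is not known beforehand to have finite
    measure. *)
Lemma superlevel_measure_le (mu : {sigma_finite_measure set T -> \bar R}) f b s k c :
  (0 < b <= 1)%R -> (0 < s)%R -> (0 <= k < 1)%R -> (0 < c)%R ->
  measurable_fun setT f -> (forall x, 0 <= f x) ->
  (forall E, measurable E -> mu E < +oo -> \int[mu]_(x in E) f x <=
    (k * (c * Num.max (fine (mu E) `^ b) (s `^ b)))%:E) ->
  mu [set x | (c * s `^ (b - 1))%:E < f x] <= (k * s)%:E.
Proof.
move=> b01 s0 /andP[k0 k1] c0 mf f0 Hf; set X := [set x | _].
have mX : measurable X by exact: measurable_superlevel.
have /sigma_finiteP[F [UF ndF mF]] := sigma_finiteT mu.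
have -> : X = \bigcup_n (X `&` F n) by rewrite -setI_bigcupr -UF setIT.
have mXF n : measurable (X `&` F n) by apply: measurableI => //; exact: (mF n).1.
rewrite -(cvg_lim _ (nondecreasing_cvg_mu mXF _ _))//; last 2 first.
- exact: bigcup_measurable.
- by move=> n m nm; apply/subsetPset; apply: setIS; move/subsetPset: (ndF n m nm).
apply: lime_le.
  apply: ereal_nondecreasing_is_cvgn => n m nm; apply: le_measure; rewrite ?inE//.
  by apply: setIS; move/subsetPset: (ndF n m nm).
apply: nearW => n; set E := X `&` F n; have mE : measurable E := mXF n.
have finE : mu E < +oo.
  have [mFn] := mF n; apply: le_lt_trans; apply: le_measure; rewrite ?inE//.
  exact: subIsetr.
set e := fine (mu E); have e0 : (0 <= e)%R by exact: fine_ge0.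
have Ee : mu E = e%:E by rewrite /e fineK ?ge0_fin_numE.
have : (c * s `^ (b - 1) * e)%:E <= \int[mu]_(x in E) f x.
  rewrite EFinM -Ee -integral_cst//; apply: ge0_le_integral => //.
  - by move=> x _; rewrite lee_fin mulr_ge0 ?powR_ge0// ltW.
  - exact: measurable_funS mf.
  - by move=> x [/ltW].
move=> /le_trans/(_ (Hf E (mXF n) finE)); rewrite /= Ee !lee_fin /=.
rewrite [leRHS]mulrCA -mulrA ler_pM2l// => {}Hf.
have sb : (s `^ b = s `^ (b - 1) * s)%R.
  by rewrite powRB ?(gt_eqF s0) ?implybT// powRr1 ?(ltW s0)// divfK// gt_eqF.
have sb0 : (0 < s `^ (b - 1))%R by exact: powR_gt0.
have [es|se] := leP e s.
  move: Hf; rewrite max_r.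
    by rewrite sb mulrCA ler_pM2l.
  by case/andP: b01 => b0 _; apply: ge0_ler_powR; rewrite ?nnegrE// ltW.
(* For [e > s] the bound becomes [s^(b-1) <= k e^(b-1) <= k s^(b-1)], impossible since [k < 1]. *)
exfalso.
have e1 : (0 < e)%R by exact: lt_trans se.
have eb : (e `^ b = e `^ (b - 1) * e)%R.
  by rewrite powRB ?(gt_eqF e1) ?implybT// powRr1// divfK// gt_eqF.
move: Hf; rewrite max_l; last first.
  by case/andP: b01 => b0 _; apply: ge0_ler_powR; rewrite ?nnegrE ?ltW.
rewrite eb mulrA ler_pM2r// => h.
have : (e `^ (b - 1) <= s `^ (b - 1))%R.
  rewrite -opprB !powRN lef_pV2 ?posrE ?powR_gt0//.
  by apply: ge0_ler_powR; rewrite ?nnegrE ?subr_ge0 ?(ltW s0) ?(ltW se)//; case/andP: b01.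
move=> /(ler_wpM2l k0)/(le_trans h); by rewrite leNgt gtr_pMl// k1.
Qed.

(* Split [E] at the level [c s^(b-1)] with [s = r * mu E] : the constant [K] bounds the
   part above the level, the level itself bounds the rest. *)
Lemma weak_integral_improve (mu : {measure set T -> \bar R}) f b c K E0 r :
  (0 < b <= 1)%R -> (0 < c)%R -> (0 <= K)%R -> (c <= K * b)%R -> (0 < r < 1)%R ->
  measurable_fun setT f -> (forall x, 0 <= f x) ->
  (forall s, (0 < s)%R -> mu [set x | (c * s `^ (b - 1))%:E < f x] <= s%:E) ->
  measurable E0 -> mu E0 < +oo ->
  (forall E, measurable E -> E `<=` E0 ->
     \int[mu]_(x in E) f x <= (K * fine (mu E) `^ b)%:E) ->
  forall E, measurable E -> E `<=` E0 -> \int[mu]_(x in E) f x <=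
    ((K * r `^ b + c * (1 - r) * r `^ (b - 1)) * fine (mu E) `^ b)%:E.
Proof.
move=> b01 c0 K0 cK /andP[r0 r1] mf f0 weakf mE0 E0fin HK E mE EE0.
have b0 : (0 < b)%R by case/andP: b01.
have fin A : measurable A -> A `<=` E0 -> mu A = (fine (mu A))%:E.
  move=> mA AE0; rewrite fineK// ge0_fin_numE//; apply: le_lt_trans E0fin.
  by apply: le_measure; rewrite ?inE.
have [E_0|E_n0] := eqVneq (mu E) 0.
  rewrite null_set_integral//; last exact: measurable_funS mf.
  by rewrite lee_fin mulr_ge0 ?powR_ge0// addr_ge0// mulr_ge0 ?powR_ge0// mulr_ge0 ?subr_ge0// ltW.
set m := fine (mu E); have Em : mu E = m%:E by exact: fin.
have m0 : (0 < m)%R by rewrite -lte_fin -Em lt_neqAle eq_sym E_n0 measure_ge0.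
set s := (r * m)%R; have s0 : (0 < s)%R by exact: mulr_gt0.
pose X := [set x | (c * s `^ (b - 1))%:E < f x].
have mX : measurable X by exact: measurable_superlevel.
have mEX : measurable (E `&` X) by exact: measurableI.
have mEDX : measurable (E `\` X) by exact: measurableD.
set e := fine (mu (E `&` X)).
have e0 : (0 <= e)%R by exact: fine_ge0.
have Ee : mu (E `&` X) = e%:E by apply: fin => // x [/EE0].
have es : (e <= s)%R.
  rewrite -lee_fin -Ee; apply: le_trans (weakf _ s0).
  by apply: le_measure; rewrite ?inE//; exact: subIsetr.
have Eme : mu (E `\` X) = (m - e)%:E.
  have -> : mu (E `\` X) = mu E - mu (E `&` X) by apply: measureD => //; rewrite [X in X < _]Em ltry.
  by rewrite Em Ee.
rewrite -{1}(setUIDK E X) ge0_integral_setU//; last 2 first.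
- exact: measurable_funS mf.
- by apply/disj_setPS => x [[_ ?] [_ /(_ _)]].
have h1 : \int[mu]_(x in E `&` X) f x <= (K * e `^ b)%:E.
  by apply: HK => // x [/EE0].
have h2 : \int[mu]_(x in E `\` X) f x <= (c * s `^ (b - 1) * (m - e))%:E.
  rewrite EFinM -Eme -integral_cst//; apply: ge0_le_integral => //.
  - exact: measurable_funS mf.
  - by move=> x [_ /negP]; rewrite -leNgt.
apply: (le_trans (leeD h1 h2)); rewrite -EFinD lee_fin.
(* Since [c <= K b], concavity shows that [K e^b + c s^(b-1) (m - e)] is at most its value at
   [e = s]. *)
have := powR_subr_ge b s e b01 s0; rewrite e0 es => /(_ isT) /(ler_wpM2l K0) h3.
have h4 : (c * ((s - e) * s `^ (b - 1)) <= K * b * ((s - e) * s `^ (b - 1)))%R.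
  by apply: ler_wpM2r => //; rewrite mulr_ge0 ?powR_ge0// subr_ge0.
have -> : ((K * r `^ b + c * (1 - r) * r `^ (b - 1)) * m `^ b =
   K * s `^ b + c * (m - s) * s `^ (b - 1))%R.
  rewrite /s !powRM ?(ltW m0) ?(ltW r0)// (@powRB _ m) ?(gt_eqF m0) ?implybT//.
  by rewrite powRr1 ?(ltW m0)//; field; rewrite gt_eqF.
by move: h3 h4; set u := (s `^ (b - 1))%R; set v := (s `^ b)%R; set w := (e `^ b)%R => h3 h4; lra.
Qed.

(** The constant [c / b] is reached by self-improvement instead of a layer-cake integration. The
    bound [M] guarantees a first admissible constant and does not enter the result. *)
Lemma weak_integral_bounded (mu : {measure set T -> \bar R}) f b c M E0 :
  (0 < b <= 1)%R -> (0 < c)%R -> (0 <= M)%R ->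
  measurable_fun setT f -> (forall x, 0 <= f x <= M%:E) ->
  (forall s, (0 < s)%R -> mu [set x | (c * s `^ (b - 1))%:E < f x] <= s%:E) ->
  measurable E0 -> mu E0 < +oo ->
  \int[mu]_(x in E0) f x <= (c / b * fine (mu E0) `^ b)%:E.
Proof.
move=> b01 c0 M0 mf fM weakf mE0 E0fin.
have /andP[b0 b1] := b01.
have f0 x : 0 <= f x by case/andP: (fM x).
have fin A : measurable A -> A `<=` E0 -> mu A = (fine (mu A))%:E.
  move=> mA AE0; rewrite fineK// ge0_fin_numE//; apply: le_lt_trans E0fin.
  by apply: le_measure; rewrite ?inE.
have bint A : measurable A -> A `<=` E0 -> \int[mu]_(x in A) f x <= (M * fine (mu A))%:E.
  move=> mA AE0; rewrite EFinM -fin// -integral_cst//; apply: ge0_le_integral => //.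
    exact: measurable_funS mf.
  by move=> x _; case/andP: (fM x).
pose P := [set K : R | (0 <= K)%R /\ forall E, measurable E -> E `<=` E0 ->
     \int[mu]_(x in E) f x <= (K * fine (mu E) `^ b)%:E].
have lbP : has_lbound P by exists 0%R => K [].
have P0 : P !=set0.
  (* Admissible because [mu(E) = mu(E)^(1-b) mu(E)^b] and [mu(E) <= mu(E0)]. *)
  exists (M * fine (mu E0) `^ (1 - b))%R; split; first by rewrite mulr_ge0 ?powR_ge0.
  move=> E mE EE0; apply: le_trans (bint _ mE EE0) _.
  have e0 : (0 <= fine (mu E))%R by exact: fine_ge0.
  rewrite lee_fin -mulrA ler_wpM2l// -{1}[fine (mu E)]powRr1//.
  have -> : 1%R = (1 - b + b)%R by ring.
  rewrite powRD; last by rewrite subrK oner_eq0.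
  rewrite addrK ler_wpM2r ?powR_ge0//; apply: ge0_ler_powR; rewrite ?nnegrE ?subr_ge0 ?fine_ge0//.
  by rewrite -lee_fin -!fin//; apply: le_measure; rewrite ?inE.
(* The best constant [K0] is stable under [weak_integral_improve] for every [r < 1];
   letting [r] tend to [1] gives [K0 * b <= c]. *)
set K0 := inf P.
have K0P K : P K -> (K0 <= K)%R by move=> PK; exact: ge_inf.
have K0b : (K0 * b <= c)%R.
  rewrite leNgt; apply/negP => cK.
  have K00 : (0 < K0)%R by rewrite -(pmulr_lgt0 _ b0) (lt_trans c0).
  have imp r : (0 < r < 1)%R -> (K0 * b * r <= c)%R.
    move=> r01; have /andP[r0 r1] := r01.
    have rb0 : (0 < r `^ b)%R by exact: powR_gt0.
    have : ((K0 - c * (1 - r) * r `^ (b - 1)) / r `^ b <= K0)%R.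
      apply: lb_le_inf => // K PK; rewrite ler_pdivrMr// lerBlDr.
      apply/K0P; case: (PK) => K_ge0 HK; split.
        by rewrite addr_ge0// mulr_ge0 ?powR_ge0// mulr_ge0 ?subr_ge0 ?ltW.
      apply: weak_integral_improve => //.
      by apply: le_trans (ltW cK) _; rewrite ler_pM2r// K0P.
    rewrite ler_pdivrMr// lerBlDr => h.
    (* [h] amounts to [K0 (1 - r^b) <= c (1 - r) r^(b-1)], and concavity gives
       [b (1 - r) <= 1 - r^b]. Cancelling [1 - r] and multiplying by [r] leaves
       [K0 b r <= c r^b <= c]. *)
    have := powR_subr_ge b 1 r b01 ltr01; rewrite (ltW r0) (ltW r1) => /(_ isT).
    rewrite !powR1 mulr1 => /(ler_wpM2l (ltW K00)) h'.
    have : (K0 * b * (1 - r) <= c * r `^ (b - 1) * (1 - r))%R by lra.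
    rewrite ler_pM2r ?subr_gt0//.
    rewrite -(ler_pM2r r0) => /le_trans; apply.
    rewrite powRB ?(gt_eqF r0) ?implybT// powRr1 ?(ltW r0)//.
    rewrite -mulrA divfK ?gt_eqF// ger_pMr//.
    by apply: le_trans (powR_le_tangent b r b01 (ltW r0)) _; nra.
  have Kb0 : (0 < K0 * b)%R by rewrite mulr_gt0.
  (* Any [r] in [(u, 1)] contradicts [imp]; the midpoint is taken. *)
  pose u := (c / (K0 * b))%R.
  have u1 : (u < 1)%R by rewrite ltr_pdivrMr ?mul1r.
  have u0 : (0 < u)%R by rewrite divr_gt0.
  have := imp ((1 + u) / 2)%R.
  have -> : (0 < (1 + u) / 2 < 1)%R by apply/andP; split; lra.
  move=> /(_ isT); have {1}-> : c = (u * (K0 * b))%R by rewrite divfK// gt_eqF.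
  rewrite leNgt => /negP; apply; rewrite mulrC ltr_pM2l//; lra.
have [E_0|E_n0] := eqVneq (mu E0) 0.
  rewrite null_set_integral//; last exact: measurable_funS mf.
  by rewrite lee_fin mulr_ge0 ?powR_ge0// divr_ge0// ltW.
set m := fine (mu E0); have Em : mu E0 = m%:E by exact: fin.
have m0 : (0 < m)%R by rewrite -lte_fin -Em lt_neqAle eq_sym E_n0 measure_ge0.
have Ifin : \int[mu]_(x in E0) f x \is a fin_num.
  rewrite ge0_fin_numE; last exact: integral_ge0.
  by apply: le_lt_trans (bint _ mE0 _) _ => //; rewrite ltry.
rewrite -(fineK Ifin) lee_fin; set I := fine _.
have mb0 : (0 < m `^ b)%R by exact: powR_gt0.
rewrite -ler_pdivrMr//; apply: (@le_trans _ _ K0); last by rewrite ler_pdivlMr.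
apply: lb_le_inf => // K [_ HK]; rewrite ler_pdivrMr// -lee_fin /I fineK//.
exact: HK.
Qed.

Lemma lim_mine_natr (x : \bar R) : (fun n : nat => mine x n%:R%:E) @ \oo --> x.
Proof.
have nd : {homo (fun n : nat => mine x n%:R%:E) : n m / (n <= m)%N >-> n <= m}.
  by move=> n m nm; rewrite le_min2// lee_fin ler_nat.
suff {2}-> : x = ereal_sup (range (fun n : nat => mine x n%:R%:E)).
  exact: ereal_nondecreasing_cvgn.
apply/eqP; rewrite eq_le; apply/andP; split; last first.
  by apply: ge_ereal_sup => _ [n _ <-]; rewrite ge_min lexx.
case: x nd => [r| |] nd; last by rewrite leNye.
- apply: ereal_sup_ubound; exists (Num.truncn `|r|).+1 => //.
  rewrite min_l// lee_fin; apply: le_trans (ler_norm r) _; apply: ltW.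
  by rewrite truncnS_gt.
- rewrite leye_eq; apply/eqP/eq_infty => r; apply: le_ereal_sup_tmp.
  exists (mine +oo (Num.truncn `|r|).+1%:R%:E); first by exists (Num.truncn `|r|).+1.
  rewrite min_r ?leey// lee_fin; apply: le_trans (ler_norm r) _; apply: ltW.
  by rewrite truncnS_gt.
Qed.

(** Truncation at level [n] shrinks the superlevel sets, so the bounded case applies with a constant
    free of [n]; monotone convergence removes the truncation. *)
Lemma weak_integral_le (mu : {measure set T -> \bar R}) f b c E :
  (0 < b <= 1)%R -> (0 < c)%R ->
  measurable_fun setT f -> (forall x, 0 <= f x) ->
  (forall s, (0 < s)%R -> mu [set x | (c * s `^ (b - 1))%:E < f x] <= s%:E) ->
  measurable E -> mu E < +oo ->
  \int[mu]_(x in E) f x <= (c / b * fine (mu E) `^ b)%:E.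
Proof.
move=> b01 c0 mf f0 weakf mE Efin.
pose fn (n : nat) x := mine (f x) n%:R%:E.
have mfn n : measurable_fun setT (fn n) by exact: measurable_mine.
have fn0 n x : 0 <= fn n x by rewrite le_min f0 lee_fin ler0n.
have -> : \int[mu]_(x in E) f x = \int[mu]_(x in E) limn (fn ^~ x).
  by apply: eq_integral => x _; apply/esym/cvg_lim => //; exact: lim_mine_natr.
have ndfn x : {homo fn ^~ x : n m / (n <= m)%N >-> n <= m}.
  by move=> n m nm; rewrite le_min2// lee_fin ler_nat.
rewrite monotone_convergence//; last by move=> n; exact: measurable_funS (mfn n).
apply: lime_le.
  apply: ereal_nondecreasing_is_cvgn => n m nm; apply: ge0_le_integral => //.
  - exact: measurable_funS (mfn n).
  - exact: measurable_funS (mfn m).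
  - by move=> x _; exact: ndfn.
apply: nearW => n; apply: (@weak_integral_bounded _ _ _ _ n%:R) => //.
  by move=> x; rewrite fn0 ge_min lexx orbT.
move=> s s0; apply: le_trans (weakf s s0); apply: le_measure; rewrite ?inE.
- exact: measurable_superlevel.
- exact: measurable_superlevel.
- by move=> x /=; rewrite lt_min => /andP[].
Qed.

End WeakType.

(** * The weak quasi-norm in terms of superlevel sets *)

Section WeakLnorm.
Context (R : realType).
Implicit Types (p : \bar R) (q s N c : R) (g : RL R -> \bar R).
Local Open Scope ereal_scope.

Lemma rearr_ge0 g s : 0 <= rearr g s.
Proof. by apply: le_ereal_inf_tmp => _ [m [m0 _] <-]; rewrite lee_fin ltW. Qed.

Lemma weakLnorm_ge0 p g : 0 <= weakLnorm p g.
Proof.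
apply: le_ereal_sup_tmp; exists ((1 `^ einv p)%:E * rearr g 1).
  by exists 1%R => //=; exact: ltr01.
by rewrite mule_ge0 ?rearr_ge0// lee_fin powR_ge0.
Qed.

Lemma weakLnorm_le p g N : (0 < N)%R ->
  (forall s, (0 < s)%R -> leb [set x | (N * s `^ (- einv p))%:E < g x] <= s%:E) ->
  weakLnorm p g <= N%:E.
Proof.
move=> N0 H; apply: ge_ereal_sup => _ [s /= s0 <-].
have sp0 : (0 < s `^ einv p)%R by exact: powR_gt0.
apply: (@le_trans _ _ ((s `^ einv p)%:E * (N * s `^ (- einv p))%:E)).
  rewrite lee_wpmul2l ?lee_fin ?powR_ge0//.
  apply: ereal_inf_lbound; exists (N * s `^ (- einv p))%R => //=; split.
    by rewrite mulr_gt0// powR_gt0.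
  exact: H.
by rewrite -EFinM powRN mulrCA divff ?mulr1// gt_eqF.
Qed.

(** Strictness supplies a competitor below [N s^(-1/p)] in the infimum defining the rearrangement,
    so attainment of the infimum is not at issue. *)
Lemma superlevel_weakLnorm p g N s : measurable_fun setT g ->
  weakLnorm p g < N%:E -> (0 < s)%R ->
  leb [set x | (N * s `^ (- einv p))%:E < g x] <= s%:E.
Proof.
move=> mg gN s0.
have sp0 : (0 < s `^ einv p)%R by exact: powR_gt0.
have : (s `^ einv p)%:E * rearr g s < N%:E.
  by apply: le_lt_trans gN; apply: ereal_sup_ubound; exists s.
rewrite -lte_pdivlMl// powRN mulrC EFinM => /ereal_inf_lt[_ [m [m0 Hm] <-] mN].
apply: le_trans Hm; apply: le_measure; rewrite ?inE.
- exact: measurable_superlevel.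
- exact: measurable_superlevel.
- by move=> x /=; apply: lt_trans.
Qed.

End WeakLnorm.

(** * Roots of integrals and Lebesgue norms *)

Lemma poweR_inv_le (R : realType) (q c : R) (I : \bar R) :
  0 < q -> 0 <= c -> (0 <= I)%E -> (I `^ q^-1 <= c%:E)%E = (I <= (c `^ q)%:E)%E.
Proof.
move=> q0 c0 I0; apply/idP/idP => h.
  rewrite -poweR_EFin -[leLHS](@poweRe1 _ I)// -(@mulVf _ q) ?gt_eqF// poweRrM.
  by apply: gt0_ler_poweR; rewrite ?in_itv/= ?leey ?andbT ?poweR_ge0 ?lee_fin// ltW.
have -> : c = ((c `^ q) `^ q^-1)%R by rewrite -powRrM mulfV ?gt_eqF// powRr1.
rewrite -poweR_EFin.
by apply: gt0_ler_poweR; rewrite ?in_itv/= ?leey ?andbT ?lee_fin ?powR_ge0 ?invr_ge0// ltW.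
Qed.

Section LnormReal.
Context d (T : measurableType d) (R : realType) (mu : {measure set T -> \bar R}).
Implicit Types (q : R) (f : T -> R) (D : set T).
Local Open Scope ereal_scope.

Lemma Lnorm_EFinE q f :
  Lnorm mu q%:E (EFin \o f) = (\int[mu]_x (`|f x| `^ q)%:E) `^ q^-1.
Proof. by rewrite unlock. Qed.

(** Puts a root of an integral over [D] into the form of a norm on the whole space, to which
    Minkowski's inequality applies. *)
Lemma Lnorm_indic q f D : (0 < q)%R ->
  Lnorm mu q%:E (EFin \o (f \* \1_D)%R) = (\int[mu]_(x in D) (`|f x| `^ q)%:E) `^ q^-1.
Proof.
move=> q0; rewrite Lnorm_EFinE [in RHS]integral_mkcond; congr (_ `^ _).
apply: eq_integral => x _; rewrite patchE /= indicE.
by case: ifPn => // _; rewrite ?mulr1// mulr0 normr0 powR0// gt_eqF.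
Qed.

End LnormReal.

(** * Tonelli's theorem on rectangles *)

Section Rectangles.
Context d1 d2 (T1 : measurableType d1) (T2 : measurableType d2) (R : realType).
Context (m1 : {sigma_finite_measure set T1 -> \bar R})
        (m2 : {sigma_finite_measure set T2 -> \bar R}).
Local Open Scope ereal_scope.
Context (f : T1 * T2 -> \bar R).
Context (mf : measurable_fun setT f) (f0 : forall z, 0 <= f z).

(** Restricting [f] to a strip makes the partial integral a full slice integral, whose measurability
    is part of Tonelli's theorem. *)
Lemma measurable_integral_l (F : set T2) : measurable F ->
  measurable_fun setT (fun x => \int[m2]_(y in F) f (x, y)).
Proof.
move=> mF.
have -> : (fun x => \int[m2]_(y in F) f (x, y)) =
   fubini_F m2 (f \_ (setT `*` F)).
  apply/funext => x; rewrite /fubini_F [LHS]integral_mkcond; apply: eq_integral => y _.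
  by rewrite !patchE in_setX in_setT.
apply: measurable_fun_fubini_tonelli_F => [|z]; last first.
  by rewrite patchE; case: ifP.
apply/(measurable_restrictT f) => //; first exact: measurableX.
exact: measurable_funS mf.
Qed.

Lemma measurable_integral_r (E : set T1) : measurable E ->
  measurable_fun setT (fun y => \int[m1]_(x in E) f (x, y)).
Proof.
move=> mE.
have -> : (fun y => \int[m1]_(x in E) f (x, y)) =
   fubini_G m1 (f \_ (E `*` setT)).
  apply/funext => x; rewrite /fubini_G [LHS]integral_mkcond; apply: eq_integral => y _.
  by rewrite !patchE in_setX in_setT andbT.
apply: measurable_fun_fubini_tonelli_G => [|z]; last first.
  by rewrite patchE; case: ifP.
apply/(measurable_restrictT f) => //; first exact: measurableX.
exact: measurable_funS mf.
Qed.

Lemma integral_rectangle_l (E : set T1) (F : set T2) :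
  measurable E -> measurable F ->
  \int[m1 \x m2]_(z in E `*` F) f z = \int[m1]_(x in E) \int[m2]_(y in F) f (x, y).
Proof.
move=> mE mF; rewrite integral_mkcond fubini_tonelli1; last 2 first.
- apply/(measurable_restrictT f); first exact: measurableX.
  exact: measurable_funS mf.
- by move=> z; rewrite patchE; case: ifP.
rewrite [RHS]integral_mkcond; apply: eq_integral => x _; rewrite /fubini_F patchE.
case: ifPn => xE.
  rewrite [RHS]integral_mkcond; apply: eq_integral => y _.
  by rewrite !patchE in_setX xE.
rewrite -[RHS](integral0 m2 setT); apply: eq_integral => y _.
by rewrite !patchE in_setX (negbTE xE).
Qed.

Lemma integral_rectangle_r (E : set T1) (F : set T2) :
  measurable E -> measurable F ->
  \int[m1 \x m2]_(z in E `*` F) f z = \int[m2]_(y in F) \int[m1]_(x in E) f (x, y).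
Proof.
move=> mE mF; rewrite integral_mkcond fubini_tonelli2; last 2 first.
- apply/(measurable_restrictT f); first exact: measurableX.
  exact: measurable_funS mf.
- by move=> z; rewrite patchE; case: ifP.
rewrite [RHS]integral_mkcond; apply: eq_integral => y _; rewrite /fubini_G patchE.
case: ifPn => yF.
  rewrite [RHS]integral_mkcond; apply: eq_integral => x _.
  by rewrite !patchE in_setX yF andbT.
rewrite -[RHS](integral0 m1 setT); apply: eq_integral => x _.
by rewrite !patchE in_setX (negbTE yF) andbF.
Qed.

End Rectangles.

Arguments measurable_integral_l {d1 d2 T1 T2 R} m2 {f} mf f0 {F} mF.
Arguments measurable_integral_r {d1 d2 T1 T2 R} m1 {f} mf f0 {E} mE.
Arguments integral_rectangle_l {d1 d2 T1 T2 R} m1 m2 {f} mf f0 {E F} mE mF.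
Arguments integral_rectangle_r {d1 d2 T1 T2 R} m1 m2 {f} mf f0 {E F} mE mF.

(** * Arithmetic of the exponents *)

Section Exponents.
Context (R : realType) (p : \bar R) (q : R) (hq : 1 <= q) (hqp : (q%:E < p)%E).

Lemma q_gt0 : 0 < q. Proof. exact: lt_le_trans hq. Qed.

Lemma conj_exponent : 0 < 1 - q * einv p <= 1.
Proof.
have q0 := q_gt0; move: hqp; case: p => [r| |] //=; last first.
  by move=> _; rewrite mulr0 subr0 ltr01 lexx.
rewrite lte_fin => qr; have r0 : 0 < r by exact: lt_trans qr.
by rewrite subr_gt0 ltr_pdivrMr// mul1r qr gerBl divr_ge0// ltW.
Qed.

Lemma powR_einv (N s : R) : 0 <= N -> 0 <= s ->
  (N * s `^ (- einv p)) `^ q = N `^ q * s `^ (1 - q * einv p - 1).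
Proof.
move=> N0 s0; rewrite powRM ?powR_ge0// -powRrM; congr (_ * _ `^ _); ring.
Qed.

Lemma powR_alpha (m : R) : (m `^ alpha p q) `^ q = m `^ (1 - q * einv p).
Proof.
rewrite -powRrM /alpha; congr (_ `^ _); field.
by rewrite gt_eqF// q_gt0.
Qed.

Lemma powR_Cpq : Cpq p q `^ q = 1 - q * einv p.
Proof.
have /andP[b0 _] := conj_exponent.
by rewrite /Cpq -powRrM mulVf ?gt_eqF ?q_gt0// powRr1// ltW.
Qed.

Lemma Cpq_gt0 : 0 < Cpq p q.
Proof. by have /andP[b0 _] := conj_exponent; exact: powR_gt0. Qed.

End Exponents.

(** * Rectangle bounds from slice norms, and the lower estimate *)

Section WeakSlices.
Context (R : realType) (p : \bar R) (q : R) (hq : 1 <= q) (hqp : (q%:E < p)%E).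
Implicit Types (h : RL R -> \bar R) (a : RL R * RL R -> R) (E F : set (RL R)).
Local Open Scope ereal_scope.
Local Notation be := (1 - q * einv p)%R.

(** Raising to the power [q] turns the weak level [N s^(-1/p)] into [N^q s^(be-1)], the shape of the
    weak-type hypotheses above. *)
Lemma superlevel_root h (N s : R) : (forall x, 0 <= h x) -> (0 <= N)%R -> (0 <= s)%R ->
  [set x | (N * s `^ (- einv p))%:E < h x `^ q^-1] =
  [set x | (N `^ q * s `^ (be - 1))%:E < h x].
Proof.
move=> h0 N0 s0; apply/seteqP; split => x /=.
  by rewrite !ltNge poweR_inv_le ?(q_gt0 _ q)// ?mulr_ge0 ?powR_ge0// powR_einv.
by rewrite !ltNge poweR_inv_le ?(q_gt0 _ q)// ?mulr_ge0 ?powR_ge0// powR_einv.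
Qed.

Lemma weakLnorm_root_le h (N : R) : (forall x, 0 <= h x) -> (0 < N)%R ->
  (forall s, (0 < s)%R -> leb [set x | (N `^ q * s `^ (be - 1))%:E < h x] <= s%:E) ->
  weakLnorm p (fun x => h x `^ q^-1) <= N%:E.
Proof.
move=> h0 N0 H; apply: weakLnorm_le => // s s0.
by rewrite superlevel_root ?(ltW N0) ?(ltW s0)//; exact: H.
Qed.

(** This is [weak_integral_le] with [c = N^q]: its factor [1 / be] equals [C(p,q)^(-q)], the origin
    of the constant in the lower bound. *)
Lemma weakLnorm_root_integral h (N : R) E : measurable_fun setT h ->
  (forall x, 0 <= h x) -> (0 < N)%R -> weakLnorm p (fun x => h x `^ q^-1) < N%:E ->
  measurable E -> leb E < +oo ->
  \int[leb]_(x in E) h x <= ((N * fine (leb E) `^ alpha p q / Cpq p q) `^ q)%:E.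
Proof.
move=> mh h0 N0 hN mE Efin.
have q0 := @q_gt0 _ q hq.
have C0 := @Cpq_gt0 _ p q hq hqp.
have -> : ((N * fine (leb E) `^ alpha p q / Cpq p q) `^ q =
   N `^ q / be * fine (leb E) `^ be)%R.
  rewrite !powRM ?mulr_ge0 ?powR_ge0 ?invr_ge0 ?(ltW N0) ?(ltW C0)//.
  rewrite powR_alpha// -powR_inv1 ?(ltW C0)// -powRrM mulN1r powRN powR_Cpq//.
  by rewrite mulrAC.
apply: weak_integral_le => //; first exact: conj_exponent.
  exact: powR_gt0.
move=> s s0; rewrite -superlevel_root ?(ltW N0) ?(ltW s0)//.
apply: superlevel_weakLnorm => //.
exact: measurableT_comp (measurable_poweR _) mh.
Qed.

Lemma measurable_norm_powR a : measurable_fun setT a ->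
  measurable_fun setT (fun z => (`|a z| `^ q)%:E).
Proof.
move=> ma; apply/measurable_EFinP; apply: (measurableT_comp (measurable_powR q)).
exact: measurableT_comp ma.
Qed.

Lemma normA0E a : normA0 p q a =
  weakLnorm p (fun x => (\int[leb]_y (`|a (x, y)| `^ q)%:E) `^ q^-1).
Proof. by congr weakLnorm; apply/funext => x; rewrite Lnorm_EFinE. Qed.

Lemma normA1E a : normA1 p q a =
  weakLnorm p (fun y => (\int[leb]_x (`|a (x, y)| `^ q)%:E) `^ q^-1).
Proof. by congr weakLnorm; apply/funext => x; rewrite Lnorm_EFinE. Qed.

(** After Tonelli, each slice integral over [F] is at most the one over the whole line, so only the
    measure of [E] enters. *)
Lemma rectangle_normA0 a (N : R) E F : measurable_fun setT a -> (0 < N)%R ->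
  normA0 p q a < N%:E -> measurable E -> measurable F -> leb E < +oo ->
  (\int[(leb \x leb)]_(z in E `*` F) (`|a z| `^ q)%:E) `^ q^-1 <=
  (N * fine (leb E) `^ alpha p q / Cpq p q)%:E.
Proof.
move=> ma N0 aN mE mF Efin; have mA := measurable_norm_powR _ ma.
have q0 := @q_gt0 _ q hq.
have C0 := @Cpq_gt0 _ p q hq hqp.
have A0 z : 0 <= (`|a z| `^ q)%:E by rewrite lee_fin powR_ge0.
rewrite poweR_inv_le//; last 2 first.
- by rewrite divr_ge0 ?mulr_ge0 ?powR_ge0 ?ltW.
- exact: integral_ge0.
rewrite (integral_rectangle_l _ _ mA A0)//.
rewrite normA0E in aN.
have h0 x : 0 <= \int[leb]_y (`|a (x, y)| `^ q)%:E by exact: integral_ge0.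
have := weakLnorm_root_integral (fun x => \int[leb]_y (`|a (x, y)| `^ q)%:E) N E.
move=> /(_ (measurable_integral_l leb mA A0 measurableT) _ N0 aN mE Efin).
move=> /(_ h0); apply: le_trans.
apply: ge0_le_integral => //.
- by move=> x _; exact: integral_ge0.
- exact: measurable_funS (measurable_integral_l _ mA A0 mF).
- exact: measurable_funS (measurable_integral_l _ mA A0 measurableT).
- move=> x _; apply: ge0_subset_integral => //.
  exact: measurableT_comp mA (measurable_pair1 x).
Qed.

Lemma rectangle_normA1 a (N : R) E F : measurable_fun setT a -> (0 < N)%R ->
  normA1 p q a < N%:E -> measurable E -> measurable F -> leb F < +oo ->
  (\int[(leb \x leb)]_(z in E `*` F) (`|a z| `^ q)%:E) `^ q^-1 <=
  (N * fine (leb F) `^ alpha p q / Cpq p q)%:E.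
Proof.
move=> ma N0 aN mE mF Ffin; have mA := measurable_norm_powR _ ma.
have q0 := @q_gt0 _ q hq.
have C0 := @Cpq_gt0 _ p q hq hqp.
have A0 z : 0 <= (`|a z| `^ q)%:E by rewrite lee_fin powR_ge0.
rewrite poweR_inv_le//; last 2 first.
- by rewrite divr_ge0 ?mulr_ge0 ?powR_ge0 ?ltW.
- exact: integral_ge0.
rewrite (integral_rectangle_r _ _ mA A0)//.
rewrite normA1E in aN.
have h0 x : 0 <= \int[leb]_y (`|a (y, x)| `^ q)%:E by exact: integral_ge0.
have := weakLnorm_root_integral (fun x => \int[leb]_y (`|a (y, x)| `^ q)%:E) N F.
move=> /(_ (measurable_integral_r leb mA A0 measurableT) _ N0 aN mF Ffin).
move=> /(_ h0); apply: le_trans.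
apply: ge0_le_integral => //.
- by move=> x _; exact: integral_ge0.
- exact: measurable_funS (measurable_integral_r _ mA A0 mE).
- exact: measurable_funS (measurable_integral_r _ mA A0 measurableT).
- move=> x _; apply: ge0_subset_integral => //.
  exact: measurableT_comp mA (measurable_pair2 x).
Qed.

Lemma rectangle_minkowski a (b c : RL R * RL R -> R) E F :
  measurable_fun setT b -> measurable_fun setT c -> a = (b \+ c)%R ->
  measurable E -> measurable F ->
  (\int[(leb \x leb)]_(z in E `*` F) (`|a z| `^ q)%:E) `^ q^-1 <=
  (\int[(leb \x leb)]_(z in E `*` F) (`|b z| `^ q)%:E) `^ q^-1 +
  (\int[(leb \x leb)]_(z in E `*` F) (`|c z| `^ q)%:E) `^ q^-1.
Proof.
move=> mb mc -> mE mF; have q0 := @q_gt0 _ q hq.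
rewrite -!Lnorm_indic//.
have -> : ((b \+ c) \* \1_(E `*` F) = (b \* \1_(E `*` F)) \+ (c \* \1_(E `*` F)))%R.
  by apply/funext => z /=; rewrite mulrDl.
have mEF : measurable (E `*` F) by exact: measurableX.
apply: eminkowski; rewrite ?lee_fin//.
- by apply: measurable_funM => //; exact: measurable_indic.
- by apply: measurable_funM => //; exact: measurable_indic.
Qed.

Lemma Cpq_tnorm_le_Kfun (t : R) a : (0 < t)%R ->
  (Cpq p q)%:E * tnorm p q t a <= Kfun p q t a.
Proof.
move=> t0; have q0 := @q_gt0 _ q hq.
have C0 := @Cpq_gt0 _ p q hq hqp.
apply: le_ereal_inf_tmp => _ [[b c] /= [mb [mc abc]] <-].
have n0 : 0 <= normA0 p q b by exact: weakLnorm_ge0.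
have n1 : 0 <= normA1 p q c by exact: weakLnorm_ge0.
have [->|] := eqVneq (normA0 p q b) +oo.
  by rewrite addye ?leey// gt_eqF// (lt_le_trans ltNy0)// mule_ge0// lee_fin ltW.
have [->|] := eqVneq (normA1 p q c) +oo.
  by rewrite gt0_muley ?lte_fin// addey ?leey// gt_eqF// (lt_le_trans ltNy0).
rewrite -!ltey; case bu: (normA0 p q b) n0 => [u| |]// n0.
case cv: (normA1 p q c) n1 => [v| |]// n1 _ _.
rewrite -lee_pdivlMl//; apply: ge_ereal_sup => _ [[E F] /= [mE [mF [/andP[E0 Efin] /andP[F0 Ffin]]]] <-].
rewrite !lee_fin in n0 n1.
set M := Num.max _ _.
have fE0 : (0 < fine (leb E))%R by rewrite fine_gt0// E0.
have fF0 : (0 < fine (leb F))%R by rewrite fine_gt0// F0.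
have M1 : (fine (leb E) `^ alpha p q <= M)%R by rewrite le_max lexx.
(* The factor [t^-1] in the second term of [M] becomes the weight [t] of the second norm in the
   K-functional. *)
have M2 : (fine (leb F) `^ alpha p q <= t * M)%R.
  by rewrite -ler_pdivrMl// le_max lexx orbT.
have M0 : (0 < M)%R by apply: lt_le_trans M1; exact: powR_gt0.
rewrite lee_pdivrMl//; apply/lee_addgt0Pr => e e0.
(* The rectangle bounds ask for strict inequalities, so [u] and [v] are enlarged by [d]; the total
   cost [M (1 + t) d / C(p,q)] is exactly [e]. *)
pose d := (e * Cpq p q / (M * (1 + t)))%R.
have t10 : (0 < 1 + t)%R by rewrite addr_gt0.
have d0 : (0 < d)%R by rewrite divr_gt0 ?mulr_gt0.
apply: le_trans (rectangle_minkowski _ _ _ _ _ mb mc abc mE mF) _.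
have hb : normA0 p q b < (u + d)%:E by rewrite bu lte_fin ltrDl.
have hc : normA1 p q c < (v + d)%:E by rewrite cv lte_fin ltrDl.
have ud0 : (0 < u + d)%R by rewrite ltr_wpDl.
have vd0 : (0 < v + d)%R by rewrite ltr_wpDl.
apply: le_trans (leeD (rectangle_normA0 _ _ _ _ mb ud0 hb mE mF Efin)
                      (rectangle_normA1 _ _ _ _ mc vd0 hc mE mF Ffin)) _.
rewrite -EFinD lee_fin.
rewrite -mulrDl ler_pdivrMr//.
have -> : ((M * ((Cpq p q)^-1 * (u + t * v)) + e) * Cpq p q =
   (u + d) * M + (v + d) * (t * M))%R.
  by rewrite /d; field; rewrite !gt_eqF.
by rewrite lerD// ler_wpM2l// ltW.
Qed.

End WeakSlices.

(** * Passage to increasing unions *)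

Section IncreasingUnions.
Context d (T : measurableType d) (R : realType).
Implicit Types (G : nat -> set T) (c : \bar R).
Local Open Scope ereal_scope.

Lemma measure_bigcup_le (mu : {measure set T -> \bar R}) G c :
  (forall n, measurable (G n)) -> (forall n, G n `<=` G n.+1) ->
  (forall n, mu (G n) <= c) -> mu (\bigcup_n G n) <= c.
Proof.
move=> mG ndG Gc.
have nd : {homo G : n m / (n <= m)%N >-> (n <= m)%O}.
  apply: homo_leq => [A|A B C|n]; [exact: lexx|exact: le_trans|exact/subsetPset].
rewrite -(cvg_lim _ (nondecreasing_cvg_mu mG _ nd))//; last exact: bigcup_measurable.
apply: lime_le; last exact: nearW.
apply: ereal_nondecreasing_is_cvgn => n m nm; apply: le_measure; rewrite ?inE//.
by move/subsetPset: (nd n m nm).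
Qed.

Lemma integral_bigcup_le (mu : {measure set T -> \bar R}) f G c :
  measurable_fun setT f -> (forall x, 0 <= f x) ->
  (forall n, measurable (G n)) -> (forall n, G n `<=` G n.+1) ->
  (forall n, \int[mu]_(x in G n) f x <= c) -> \int[mu]_(x in \bigcup_n G n) f x <= c.
Proof.
move=> mf f0 mG ndG Gc.
have nd : {homo G : n m / (n <= m)%N >-> (n <= m)%O}.
  apply: homo_leq => [A|A B C|n]; [exact: lexx|exact: le_trans|exact/subsetPset].
have mfG n : measurable_fun (G n) f by exact: measurable_funS mf.
rewrite -(cvg_lim _ (ge0_nondecreasing_set_cvg_integral nd mG mfG _))//.
apply: lime_le; last exact: nearW.
apply: ereal_nondecreasing_is_cvgn.
exact: ge0_nondecreasing_set_nondecreasing_integral.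
Qed.

End IncreasingUnions.

(** * Integer-indexed scales *)

Lemma last_level (T : Type) (G : int -> set T) (x : T) (k : int) :
  (forall i j : int, i <= j -> G j `<=` G i) -> (exists j, G j x) -> ~ G (k + 1) x ->
  exists j, [/\ j <= k, G j x & ~ G (j + 1) x].
Proof.
move=> antiG [i Gi] Gk.
(* The level is found by taking the least [n] with [x] in [G (k + 1 - n)]; it is not [0], as [x]
   lies outside [G (k + 1)], whence [j = k + 1 - n <= k]. *)
have exn : exists n : nat, `[< G (k + 1 - n%:Z) x >].
  by exists (absz (k + 1 - i)%R); apply/asboolP; apply: antiG Gi; lia.
case: (ex_minnP exn) => -[|n] /asboolP; first by rewrite subr0.
move=> Gn minn; exists (k + 1 - n.+1%:Z); split => //; first lia.
have -> : k + 1 - n.+1%:Z + 1 = k + 1 - n%:Z by lia.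
by move=> /asboolP /minn; rewrite ltnn.
Qed.

Section Levels.
Context (R : realType).

Lemma powR_levels (r s : R) : 0 < r < 1 -> 0 < s ->
  exists k : int, r `^ (k + 1)%:~R <= s <= r `^ k%:~R.
Proof.
move=> /andP[r0 r1] s0; have lr0 : ln r < 0 by rewrite ln_lt0// r0.
have -> : s = r `^ (ln s / ln r).
  by rewrite /powR gt_eqF// divfK ?lt_eqF// lnK.
exists (Num.floor (ln s / ln r)); have /andP[h1 h2] := floor_itv (ln s / ln r).
by rewrite !ger_powR// ?r0 ?(ltW r1)// ltW.
Qed.

Lemma lebesgue_measure_sym_itv (e : R) : 0 <= e ->
  leb ([set` `[- e, e]] : set (RL R)) = (e *+ 2)%:E.
Proof.
move=> e0; rewrite lebesgue_measure_itv /= lte_fin.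
have [ee|ee] := ltP (- e) e; first by rewrite -EFinD opprK mulr2n.
have -> : e = 0 by lra.
by rewrite mul0rn.
Qed.

End Levels.

(** * Fixed point of the alternating construction *)

Section Iteration.
Context (R : realType) (w : RL R * RL R -> \bar R) (b kap r tau : R) (s sg : int -> R).
Local Open Scope ereal_scope.
Context (mw : measurable_fun setT w) (w0 : forall z, 0 <= w z).
Context (b01 : (0 < b <= 1)%R) (kap0 : (0 <= kap)%R) (kapr : (kap < r)%R) (r1 : (r < 1)%R).
Context (tau0 : (0 < tau)%R).
Context (s0 : forall k, (0 < s k)%R) (sg0 : forall k, (0 < sg k)%R).
Context (sS : forall k, (s (k + 1) = r * s k)%R) (sgS : forall k, (sg (k + 1) = r * sg k)%R).
Context (slev : forall u, (0 < u)%R -> exists k, (s (k + 1) <= u <= s k)%R).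
Context (sglev : forall u, (0 < u)%R -> exists k, (sg (k + 1) <= u <= sg k)%R).
Context (s_sg : forall k, (s k `^ b = tau * sg k `^ b)%R).
Context (rect : forall E F, measurable E -> measurable F -> leb E < +oo -> leb F < +oo ->
  \int[(leb \x leb)]_(z in E `*` F) w z <=
  (kap * Num.max (fine (leb E) `^ b) (tau * fine (leb F) `^ b))%:E).

(* Small intervals added at each level so that the families [E_k], [F_k] exhaust the
   line as [k -> -oo]; their measure uses up the slack [r - kap]. *)
Definition core (l : int -> R) (k : int) : set (RL R) :=
  [set` `[(- ((r - kap) * l (k - 1) / 2))%R, ((r - kap) * l (k - 1) / 2)%R]].

Definition good (l : int -> R) (G : int -> set (RL R)) :=
  forall k, [/\ measurable (G k), leb (G k) <= (l k)%:E & G (k + 1)%R `<=` G k].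

(* Level [k] of one family is built from level [k - 1] of the other one, so that the
   Markov bound [kap * s (k - 1)] fits, together with the core, into [s k]. *)
Definition Estep (F : int -> set (RL R)) (k : int) : set (RL R) :=
  [set x | (s (k - 1)%R `^ (b - 1))%:E < \int[leb]_(y in F (k - 1)%R) w (x, y)]
  `|` core s k.

(** Uses [E k], whose measure is at most [s k <= s (k - 1)], so the rectangle bound at scale [k - 1]
    still applies. With this indexing, slices at [y] outside [F (k + 1)] are controlled on all of
    [E (k + 1)], where the complement of the splitting set lives. *)
Definition Fstep (E : int -> set (RL R)) (k : int) : set (RL R) :=
  [set y | (tau * sg (k - 1)%R `^ (b - 1))%:E < \int[leb]_(x in E k) w (x, y)]
  `|` core sg k.

Let r0 : (0 < r)%R. Proof. exact: le_lt_trans kapr. Qed.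

Lemma antitone_int {T : Type} (G : int -> set T) :
  (forall k, G (k + 1)%R `<=` G k) -> forall i j : int, (i <= j)%R -> G j `<=` G i.
Proof.
move=> GS i j ij; have -> : j = (i + (absz (j - i)%R)%:Z)%R by lia.
elim: (absz _) => [|n IH]; first by rewrite addr0.
have -> : (i + n.+1%:Z = i + n%:Z + 1)%R by lia.
exact: subset_trans (GS _) IH.
Qed.

Lemma level_le (l : int -> R) (k : int) : (forall k, 0 < l k)%R ->
  (forall k, l (k + 1) = r * l k)%R -> (l (k + 1) <= l k)%R.
Proof. by move=> l0 lS; rewrite lS ger_pMl// ltW. Qed.

Lemma level_shift (l : int -> R) (k : int) :
  (forall k, l (k + 1) = r * l k)%R -> (l k = r * l (k - 1))%R.
Proof. by move=> lS; rewrite -lS subrK. Qed.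

Lemma antitone_level (l : int -> R) (i j : int) : (forall k, 0 < l k)%R ->
  (forall k, l (k + 1) = r * l k)%R -> (i <= j)%R -> (l j <= l i)%R.
Proof.
move=> l0 lS ij; have -> : j = (i + (absz (j - i)%R)%:Z)%R by lia.
elim: (absz _) => [|n IH]; first by rewrite addr0.
have -> : (i + n.+1%:Z = i + n%:Z + 1)%R by lia.
exact: le_trans (level_le _ _ l0 lS) IH.
Qed.

Lemma core_half_ge0 (l : int -> R) (k : int) : (forall k, 0 < l k)%R ->
  (0 <= (r - kap) * l (k - 1) / 2)%R.
Proof. by move=> l0; rewrite divr_ge0// mulr_ge0 ?subr_ge0// ltW. Qed.

Lemma core_measurable l k : measurable (core l k).
Proof. exact: measurable_itv. Qed.

Lemma core_S (l : int -> R) k : (forall k, 0 < l k)%R ->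
  (forall k, l (k + 1) = r * l k)%R -> core l (k + 1)%R `<=` core l k.
Proof.
move=> l0 lS x; rewrite /core /= !in_itv /= -!ler_norml => /le_trans; apply.
rewrite ler_wpM2r// ler_wpM2l ?subr_ge0 ?(ltW kapr)//.
by rewrite addrAC; exact: level_le.
Qed.

Lemma core_cover (l : int -> R) (x : RL R) : (forall k, 0 < l k)%R ->
  (forall u, 0 < u -> exists k, l (k + 1) <= u <= l k)%R -> exists k, core l k x.
Proof.
move=> l0 llev; have rk0 : (0 < r - kap)%R by rewrite subr_gt0.
have u0 : (0 < (`|x| + 1) * 2 / (r - kap))%R.
  by rewrite divr_gt0// mulr_gt0// ltr_wpDl.
have [k /andP[_]] := llev _ u0; rewrite ler_pdivrMr// => h.
exists (k + 1)%R; rewrite /core /= in_itv /= -ler_norml addrK.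
by rewrite ler_pdivlMr// [leRHS]mulrC; apply: le_trans h; rewrite ler_wpM2r// lerDl.
Qed.

(** The Markov part has measure at most [kap * l (k - 1)] and the core [(r - kap) * l (k - 1)]; the
    sum is [r * l (k - 1) = l k]. *)
Lemma superlevelU_core_le (l : int -> R) k f (c : R) : (forall k, 0 < l k)%R ->
  (forall k, l (k + 1) = r * l k)%R -> (0 < c)%R ->
  measurable_fun setT f -> (forall x : RL R, 0 <= f x) ->
  (forall E, measurable E -> leb E < +oo -> \int[leb]_(x in E) f x <=
    (kap * (c * Num.max (fine (leb E) `^ b) (l (k - 1)%R `^ b)))%:E) ->
  leb ([set x | (c * l (k - 1)%R `^ (b - 1))%:E < f x] `|` core l k) <= (l k)%:E.
Proof.
move=> l0 lS c0 mf f0 Hf.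
have mX := measurable_superlevel _ _ _ f (c * l (k - 1)%R `^ (b - 1))%:E mf.
apply: le_trans (measureU2 _ mX (core_measurable l k)) _.
have h : leb (core l k) <= ((r - kap) * l (k - 1)%R)%:E.
  by rewrite lebesgue_measure_sym_itv ?core_half_ge0// lee_fin -[leLHS]mulr_natr divfK.
have k01 : (0 <= kap < 1)%R by rewrite kap0 (lt_trans kapr).
apply: le_trans (leeD (superlevel_measure_le _ _ _ _ _ _ _ _ _ b01 (l0 _) k01 c0 mf f0 Hf) h) _.
by rewrite -EFinD lee_fin -mulrDl subrKC -level_shift.
Qed.

Lemma powR_exponent_anti (x y : R) : (0 < x <= y)%R -> (y `^ (b - 1) <= x `^ (b - 1))%R.
Proof.
move=> /andP[x0 xy]; have y0 : (0 < y)%R by exact: lt_le_trans xy.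
rewrite -opprB !powRN lef_pV2 ?posrE ?powR_gt0//.
apply: ge0_ler_powR; rewrite ?nnegrE ?subr_ge0 ?(ltW x0) ?(ltW y0)//.
by case/andP: b01.
Qed.

Let mwl x : measurable_fun setT (fun y => w (x, y)).
Proof. exact: measurableT_comp mw (measurable_pair1 x). Qed.

Let mwr y : measurable_fun setT (fun x => w (x, y)).
Proof. exact: measurableT_comp mw (measurable_pair2 y). Qed.

Lemma fine_powR_le (A : set (RL R)) (m : R) : leb A <= m%:E ->
  (fine (leb A) `^ b <= m `^ b)%R.
Proof.
move=> Am; have A0 : 0 <= leb A by exact: measure_ge0.
have Af : leb A \is a fin_num by rewrite ge0_fin_numE// (le_lt_trans Am) ?ltry.
have m0 : (0 <= m)%R by rewrite -lee_fin (le_trans A0).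
have /andP[b0 _] := b01.
apply: ge0_ler_powR; rewrite ?nnegrE ?fine_ge0 ?(ltW b0)//.
by rewrite -lee_fin fineK.
Qed.

Lemma good_fin l G k : good l G -> leb (G k) < +oo.
Proof. by move=> /(_ k)[_ /le_lt_trans + _]; apply; rewrite ltry. Qed.

(** By [s_sg], the bound [rect] with second side [F (k - 1)] is the Markov hypothesis at scale
    [s (k - 1)]. The new family decreases because, as [k] grows, the threshold does not fall while
    the set of integration shrinks. *)
Lemma Estep_good F : good sg F -> good s (Estep F).
Proof.
move=> gF k; have [mF Fle _] := gF (k - 1)%R.
have mf := measurable_integral_l leb mw w0 mF.
split.
- by apply: measurableU; [exact: measurable_superlevel|exact: core_measurable].
- have := superlevelU_core_le s k (fun x => \int[leb]_(y in F (k - 1)%R) w (x, y)) 1.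
  rewrite mul1r; apply => //; first by move=> x; exact: integral_ge0.
  move=> E mE Efin; rewrite -(integral_rectangle_l _ _ mw w0)//.
  apply: le_trans (rect _ _ mE mF Efin (good_fin _ _ _ gF)) _.
  rewrite lee_fin ler_wpM2l// mul1r s_sg; apply: le_max2 => //.
  by rewrite ler_pM2l//; exact: fine_powR_le.
- move=> x [xk|/core_S xk]; [left|right; exact: xk]; move: xk => /=.
  rewrite addrK => h; have [mFk _ _] := gF k.
  apply: (@le_lt_trans _ _ (s k `^ (b - 1))%:E).
    rewrite lee_fin; apply: powR_exponent_anti; rewrite s0/=.
    by have := @level_le s (k - 1)%R s0 sS; rewrite subrK.
  apply: lt_le_trans h _; apply: ge0_subset_integral => //.
    exact: measurable_funS (mwl x).
  by have [_ _] := gF (k - 1)%R; rewrite subrK.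
Qed.

Lemma Fstep_good E : good s E -> good sg (Fstep E).
Proof.
move=> gE k; have [mE Ele ES] := gE k.
have mf := measurable_integral_r leb mw w0 mE.
split.
- by apply: measurableU; [exact: measurable_superlevel|exact: core_measurable].
- apply: (superlevelU_core_le sg k (fun y => \int[leb]_(x in E k) w (x, y))) => //.
    by move=> y; exact: integral_ge0.
  move=> F mF Ffin; rewrite -(integral_rectangle_r _ _ mw w0)//.
  apply: le_trans (rect _ _ mE mF (good_fin _ _ _ gE) Ffin) _.
  rewrite lee_fin ler_wpM2l// maxr_pMr ?(ltW tau0)// -s_sg maxC; apply: le_max2 => //.
  apply: fine_powR_le; apply: le_trans Ele _; rewrite lee_fin.
  by have := @level_le s (k - 1)%R s0 sS; rewrite subrK.
- move=> y [yk|/core_S yk]; [left|right; exact: yk]; move: yk => /=.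
  rewrite addrK => h; have [mEk _ _] := gE (k + 1)%R.
  apply: (@le_lt_trans _ _ (tau * sg k `^ (b - 1))%:E).
    rewrite lee_fin ler_pM2l//; apply: powR_exponent_anti; rewrite sg0/=.
    by have := @level_le sg (k - 1)%R sg0 sgS; rewrite subrK.
  apply: lt_le_trans h _; apply: ge0_subset_integral => //.
  exact: measurable_funS (mwr y).
Qed.

Lemma Estep_sub F F' : good sg F -> good sg F' -> (forall k, F k `<=` F' k) ->
  forall k, Estep F k `<=` Estep F' k.
Proof.
move=> gF gF' FF' k x [xk|xk]; [left|by right]; move: xk => /= /lt_le_trans; apply.
have [mF _ _] := gF (k - 1)%R; have [mF' _ _] := gF' (k - 1)%R.
apply: ge0_subset_integral => //; exact: measurable_funS (mwl x).
Qed.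

Lemma Fstep_sub E E' : good s E -> good s E' -> (forall k, E k `<=` E' k) ->
  forall k, Fstep E k `<=` Fstep E' k.
Proof.
move=> gE gE' EE' k x [xk|xk]; [left|by right]; move: xk => /= /lt_le_trans; apply.
have [mE _ _] := gE k; have [mE' _ _] := gE' k.
apply: ge0_subset_integral => //; exact: measurable_funS (mwr x).
Qed.

(** Iteration of a monotone map from the empty family: the families increase with [n], and their
    unions serve as the common fixed point. *)
Definition Fseq (n : nat) : int -> set (RL R) :=
  iter n (fun F => Fstep (Estep F)) (fun _ => set0).

Definition Eseq (n : nat) : int -> set (RL R) := Estep (Fseq n).

Lemma Fseq_good n : good sg (Fseq n).
Proof.
elim: n => [|n IH] /=; last by apply: Fstep_good; exact: Estep_good.
by move=> k; split => //; rewrite measure0 lee_fin ltW.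
Qed.

Lemma Eseq_good n : good s (Eseq n).
Proof. by apply: Estep_good; exact: Fseq_good. Qed.

Lemma Fseq_nd n k : Fseq n k `<=` Fseq n.+1 k.
Proof.
elim: n k => [|n IH] k //; change (Fstep (Eseq n) k `<=` Fstep (Eseq n.+1) k).
apply: Fstep_sub; [exact: Eseq_good|exact: Eseq_good|].
by apply: Estep_sub => //; exact: Fseq_good.
Qed.

Lemma Eseq_nd n k : Eseq n k `<=` Eseq n.+1 k.
Proof. by apply: Estep_sub; [exact: Fseq_good|exact: Fseq_good|move=> j; exact: Fseq_nd]. Qed.

Definition Einf (k : int) : set (RL R) := \bigcup_n Eseq n k.
Definition Finf (k : int) : set (RL R) := \bigcup_n Fseq n k.

Lemma Einf_good : good s Einf.
Proof.
move=> k; split.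
- by apply: bigcup_measurable => n _; have [] := Eseq_good n k.
- apply: measure_bigcup_le => n; [by have [] := Eseq_good n k|exact: Eseq_nd|].
  by have [] := Eseq_good n k.
- by apply: subset_bigcup => n _; have [] := Eseq_good n k.
Qed.

Lemma Finf_good : good sg Finf.
Proof.
move=> k; split.
- by apply: bigcup_measurable => n _; have [] := Fseq_good n k.
- apply: measure_bigcup_le => n; [by have [] := Fseq_good n k|exact: Fseq_nd|].
  by have [] := Fseq_good n k.
- by apply: subset_bigcup => n _; have [] := Fseq_good n k.
Qed.

(** A slice mass above the threshold in some [Fseq n k] would put [x] in [Eseq n (k + 1)]; the bound
    at every stage passes to the union by monotone convergence. *)
Lemma integral_Finf_le x k : ~ Einf (k + 1)%R x ->
  \int[leb]_(y in Finf k) w (x, y) <= (s k `^ (b - 1))%:E.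
Proof.
move=> xE; apply: integral_bigcup_le => // n; [by have [] := Fseq_good n k|exact: Fseq_nd|].
rewrite leNgt; apply/negP => h; apply: xE; exists n => //; left => /=.
by rewrite addrK.
Qed.

(** Here stage [n] of [Eseq] feeds stage [n + 1] of [Fseq], both at level [k + 1]. *)
Lemma integral_Einf_le y k : ~ Finf (k + 1)%R y ->
  \int[leb]_(x in Einf (k + 1)%R) w (x, y) <= (tau * sg k `^ (b - 1))%:E.
Proof.
move=> yF; apply: integral_bigcup_le => // n; [by have [] := Eseq_good n (k + 1)%R|exact: Eseq_nd|].
rewrite leNgt; apply/negP => h; apply: yF; exists n.+1 => //; left => /=.
by rewrite addrK.
Qed.

Definition splitting_set : set (RL R * RL R) :=
  \bigcup_k ((~` Einf (k + 1)%R) `*` Finf k).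

Lemma measurable_splitting_set : measurable splitting_set.
Proof.
apply: countable_bigcupT_measurable => [|k]; first exact: (@countableP int).
apply: measurableX.
- by apply: measurableC; have [] := Einf_good (k + 1)%R.
- by have [] := Finf_good k.
Qed.

(** Outside [Einf (k + 1)], of measure at most [s (k + 1) <= u], let [j <= k] be the last level
    containing [x]. The slice of [splitting_set] at [x] lies in [Finf j], and [u <= s k <= s j]
    compares the thresholds. *)
Lemma weak_splitting_l u : (0 < u)%R ->
  leb [set x | (u `^ (b - 1))%:E < \int[leb]_y ((w \_ splitting_set) (x, y))] <= u%:E.
Proof.
move=> u0; have [k /andP[sku usk]] := slev _ u0.
have [mE Ele _] := Einf_good (k + 1)%R.
apply: (@le_trans _ _ (leb (Einf (k + 1)%R))); last first.
  by apply: le_trans Ele _; rewrite lee_fin.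
have mwA : measurable_fun setT (w \_ splitting_set).
  apply/(measurable_restrictT w); first exact: measurable_splitting_set.
  exact: measurable_funS mw.
have wA0 z : 0 <= (w \_ splitting_set) z by rewrite patchE; case: ifP.
apply: le_measure; rewrite ?inE//.
  exact: measurable_superlevel (measurable_integral_l leb mwA wA0 measurableT).
move=> x /= hx; apply: contrapT => xE.
have [j [jk xj xj1]] : exists j, [/\ (j <= k)%R, Einf j x & ~ Einf (j + 1)%R x].
  apply: last_level => //.
    by apply: antitone_int => i; have [] := Einf_good i.
  have [j xj] := core_cover s x s0 slev.
  by exists j; exists 0%N => //; right.
have : \int[leb]_y ((w \_ splitting_set) (x, y)) <= (s j `^ (b - 1))%:E.
  apply: le_trans (integral_Finf_le _ _ xj1).
  rewrite [leRHS]integral_mkcond; apply: ge0_le_integral => //.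
  - exact: measurableT_comp mwA (measurable_pair1 x).
  - apply/(measurable_restrictT (fun y => w (x, y))).
      by have [] := Finf_good j.
    exact: measurable_funS (mwl x).
  - move=> y _; rewrite !patchE; case: ifPn => [|_]; last by case: ifP.
    rewrite inE => -[i _ [/= xi yi]]; rewrite ifT// inE.
    (* [x] is in [Einf j] but outside [Einf (i + 1)], and the family decreases. *)
    have ji : (j <= i)%R.
      rewrite leNgt; apply/negP => ij; apply: xi; move: xj.
      by apply: antitone_int; [move=> i'; have [] := Einf_good i'|lia].
    by move: yi; apply: antitone_int => // i'; have [] := Finf_good i'.
move/(lt_le_trans hx); rewrite lte_fin ltNge => /negP; apply.
apply: powR_exponent_anti; rewrite u0 (le_trans usk)//.
by apply: antitone_level.
Qed.

(** For [y] in [Finf j], a point [(x, y)] off [splitting_set] has [x] in [Einf (j + 1)]; at the last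
    level [j] of [y], [integral_Einf_le] controls that slice. *)
Lemma weak_splitting_r u : (0 < u)%R ->
  leb [set y | (tau * u `^ (b - 1))%:E < \int[leb]_x ((w \_ (~` splitting_set)) (x, y))] <= u%:E.
Proof.
move=> u0; have [k /andP[sku usk]] := sglev _ u0.
have [mF Fle _] := Finf_good (k + 1)%R.
apply: (@le_trans _ _ (leb (Finf (k + 1)%R))); last first.
  by apply: le_trans Fle _; rewrite lee_fin.
have mwA : measurable_fun setT (w \_ (~` splitting_set)).
  apply/(measurable_restrictT w); first by apply: measurableC; exact: measurable_splitting_set.
  exact: measurable_funS mw.
have wA0 z : 0 <= (w \_ (~` splitting_set)) z by rewrite patchE; case: ifP.
apply: le_measure; rewrite ?inE//.
  exact: measurable_superlevel (measurable_integral_r leb mwA wA0 measurableT).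
move=> y /= hy; apply: contrapT => yF.
have [j [jk yj yj1]] : exists j, [/\ (j <= k)%R, Finf j y & ~ Finf (j + 1)%R y].
  apply: last_level => //.
    by apply: antitone_int => i; have [] := Finf_good i.
  have [j yj] := core_cover sg y sg0 sglev.
  (* Stage [1], because stage [0] of [Fseq] is empty and contains no core. *)
  by exists j; exists 1%N => //; right.
have : \int[leb]_x ((w \_ (~` splitting_set)) (x, y)) <= (tau * sg j `^ (b - 1))%:E.
  apply: le_trans (integral_Einf_le _ _ yj1).
  rewrite [leRHS]integral_mkcond; apply: ge0_le_integral => //.
  - exact: measurableT_comp mwA (measurable_pair2 y).
  - apply/(measurable_restrictT (fun x => w (x, y))).
      by have [] := Einf_good (j + 1)%R.
    exact: measurable_funS (mwr y).
  - move=> x _; rewrite !patchE; case: ifPn => [|_]; last by case: ifP.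
    rewrite inE => xyA; rewrite ifT// inE; apply: contrapT => xE.
    by apply: xyA; exists j.
move/(lt_le_trans hy); rewrite lte_fin ltr_pM2l// ltNge => /negP; apply.
apply: powR_exponent_anti; rewrite u0 (le_trans usk)//.
by apply: antitone_level.
Qed.

End Iteration.

Lemma exists_weak_splitting (R : realType) (w : RL R * RL R -> \bar R) (b kap tau : R) :
  measurable_fun setT w -> (forall z, 0 <= w z)%E -> 0 < b <= 1 -> 0 <= kap < 1 ->
  0 < tau ->
  (forall E F, measurable E -> measurable F -> (leb E < +oo)%E -> (leb F < +oo)%E ->
    (\int[(leb \x leb)]_(z in E `*` F) w z <=
      (kap * Num.max (fine (leb E) `^ b) (tau * fine (leb F) `^ b))%:E)%E) ->
  exists A : set (RL R * RL R), [/\ measurable A,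
    forall u, 0 < u ->
      (leb [set x | (u `^ (b - 1))%:E < \int[leb]_y (w \_ A) (x, y)] <= u%:E)%E &
    forall u, 0 < u ->
      (leb [set y | (tau * u `^ (b - 1))%:E < \int[leb]_x (w \_ (~` A)) (x, y)]
       <= u%:E)%E].
Proof.
move=> mw w0 b01 /andP[kap0 kap1] tau0 rect.
have /andP[b0 b1] := b01.
pose r := (1 + kap) / 2.
have kapr : kap < r by rewrite /r; lra.
have r1 : r < 1 by rewrite /r; lra.
have r0 : 0 < r by rewrite /r; lra.
pose s (k : int) := r `^ k%:~R.
(* Normalised by [tau * sg0^b = 1], which gives [s_sg]. *)
pose sg0 := tau `^ (- b^-1).
pose sg (k : int) := sg0 * s k.
have sg00 : 0 < sg0 by exact: powR_gt0.
have s_gt0 k : 0 < s k by exact: powR_gt0.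
have sg_gt0 k : 0 < sg k by exact: mulr_gt0.
have sS k : s (k + 1) = r * s k.
  rewrite /s intrD powRD; last by rewrite (gt_eqF r0) implybT.
  by rewrite powRr1 ?(ltW r0)// mulrC.
have sgS k : sg (k + 1) = r * sg k by rewrite /sg sS mulrCA.
have r01 : 0 < r < 1 by rewrite r0.
have slev u : 0 < u -> exists k, s (k + 1) <= u <= s k by exact: powR_levels.
have sglev u : 0 < u -> exists k, sg (k + 1) <= u <= sg k.
  move=> u0; have [k] := slev (u / sg0) (divr_gt0 u0 sg00).
  by rewrite ler_pdivlMr// ler_pdivrMr// ![_ * sg0]mulrC => ?; exists k.
have s_sg k : s k `^ b = tau * sg k `^ b.
  rewrite /sg powRM ?(ltW sg00) ?(ltW (s_gt0 k))// mulrA /sg0 -powRrM.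
  by rewrite mulNr mulVf ?gt_eqF// powR_inv1 ?(ltW tau0)// divff ?gt_eqF// mul1r.
exists (splitting_set R w b kap r tau s sg); split.
- exact: measurable_splitting_set.
- exact: weak_splitting_l.
- exact: weak_splitting_r.
Qed.

(** * Decomposition of [a] and the upper estimate *)

Section UpperBound.
Context (R : realType) (p : \bar R) (q t : R).
Context (hq : 1 <= q) (hqp : (q%:E < p)%E) (t0 : 0 < t).
Implicit Types (a : RL R * RL R -> R) (E F : set (RL R)).
Local Open Scope ereal_scope.
Local Notation be := (1 - q * einv p)%R.

Lemma tnorm_ge0 a : 0 <= tnorm p q t a.
Proof.
apply: le_ereal_sup_tmp.
(* One admissible rectangle, the unit square, keeps the supremum away from [-oo]. *)
pose I : set (RL R) := [set` `[0%R, 1%R]].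
have mI : measurable I by exact: measurable_itv.
have I1 : leb I = 1%:E by rewrite lebesgue_measure_itv /= lte_fin ltr01 oppr0 adde0.
eexists; first by exists (I, I) => //=; rewrite I1 lte_fin ltr01 ltry.
rewrite mule_ge0 ?poweR_ge0// lee_fin invr_ge0 le_max powR_ge0//.
Qed.

(** Null sides are excluded from the supremum but give a zero integral. Otherwise the power [q]
    turns [alpha] into [be] and [t^-1] into [t^(-q)]. *)
Lemma rectangle_le_tnorm a (N : R) E F : measurable_fun setT a -> (0 <= N)%R ->
  tnorm p q t a <= N%:E -> measurable E -> measurable F -> leb E < +oo -> leb F < +oo ->
  \int[(leb \x leb)]_(z in E `*` F) (`|a z| `^ q)%:E <=
  (N `^ q * Num.max (fine (leb E) `^ be) (t `^ (- q) * fine (leb F) `^ be))%:E.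
Proof.
move=> ma N0 aN mE mF Efin Ffin; have mA := measurable_norm_powR _ q _ ma.
have q0 := @q_gt0 _ q hq.
have A0 z : 0 <= (`|a z| `^ q)%:E by rewrite lee_fin powR_ge0.
have rhs0 : 0 <= (N `^ q * Num.max (fine (leb E) `^ be) (t `^ (- q) * fine (leb F) `^ be))%:E.
  by rewrite lee_fin mulr_ge0 ?powR_ge0// le_max powR_ge0.
have [E_0|E_n0] := eqVneq (leb E) 0.
  rewrite (integral_rectangle_l _ _ mA A0)// null_set_integral//.
  exact: measurable_funS (measurable_integral_l leb mA A0 mF).
have [F_0|F_n0] := eqVneq (leb F) 0.
  rewrite (integral_rectangle_r _ _ mA A0)// null_set_integral//.
  exact: measurable_funS (measurable_integral_r leb mA A0 mE).
have E0 : 0 < leb E by rewrite lt_neqAle eq_sym E_n0 measure_ge0.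
have F0 : 0 < leb F by rewrite lt_neqAle eq_sym F_n0 measure_ge0.
pose M := Num.max (fine (leb E) `^ alpha p q)%R (t^-1 * fine (leb F) `^ alpha p q)%R.
have M0 : (0 < M)%R by rewrite lt_max powR_gt0// fine_gt0// E0.
have : (M^-1)%:E * (\int[(leb \x leb)]_(z in E `*` F) (`|a z| `^ q)%:E) `^ q^-1 <= N%:E.
  apply: le_trans aN; apply: ereal_sup_ubound; exists (E, F) => //=.
  by rewrite E0 F0 Efin Ffin.
rewrite lee_pdivrMl// -EFinM poweR_inv_le ?mulr_ge0 ?(ltW M0)//; last exact: integral_ge0.
move=> /le_trans; apply; rewrite lee_fin powRM ?(ltW M0)// mulrC ler_wpM2l ?powR_ge0//.
rewrite le_max /M; case: (leP (fine (leb E) `^ alpha p q) _)%R => _.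
  rewrite powRM ?invr_ge0 ?(ltW t0) ?powR_ge0// powR_alpha//.
  by rewrite -powR_inv1 ?(ltW t0)// -powRrM mulN1r lexx orbT.
by rewrite powR_alpha// lexx.
Qed.

Lemma norm_indic_powR a (A : set (RL R * RL R)) (N : R) z : (0 < N)%R ->
  (`|a z * \1_A z| `^ q)%:E =
  (N `^ q)%:E * ((fun z => ((`|a z| / N) `^ q)%:E) \_ A) z.
Proof.
move=> N0; have q0 := @q_gt0 _ q hq; rewrite patchE indicE.
case: ifPn => _; last by rewrite mulr0 normr0 powR0 ?gt_eqF// mule0.
by rewrite mulr1 -EFinM -powRM ?divr_ge0 ?(ltW N0)// mulrC divfK// gt_eqF.
Qed.

(** Strictness gives the gain [kap < 1] on which the iteration runs. The two pieces contribute [N]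
    and [t * (N / t)], whence the factor [2]. *)
Lemma Kfun_le_double a (N : R) : measurable_fun setT a ->
  tnorm p q t a < N%:E -> Kfun p q t a <= (2 * N)%:E.
Proof.
move=> ma aN; have q0 := @q_gt0 _ q hq.
have n0 := tnorm_ge0 a.
have N0 : (0 < N)%R by rewrite -lte_fin (le_lt_trans n0).
case au: (tnorm p q t a) aN n0 => [u| |]//; rewrite lte_fin lee_fin => uN u0.
pose w := fun z => ((`|a z| / N) `^ q)%:E.
have mw : measurable_fun setT w.
  apply/measurable_EFinP; apply: (measurableT_comp (measurable_powR q)).
  by apply: measurable_funM => //; exact: measurableT_comp ma.
have w0 z : 0 <= w z by rewrite lee_fin powR_ge0.
pose kap := ((u / N) `^ q)%R.
have kap01 : (0 <= kap < 1)%R.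
  have one : (1 `^ q = 1 :> R)%R by rewrite powR1.
  rewrite powR_ge0/= -[ltRHS]one; apply: gt0_ltr_powR => //.
  - by rewrite nnegrE divr_ge0// ltW.
  - by rewrite nnegrE.
  - by rewrite ltr_pdivrMr// mul1r.
have tau0 : (0 < t `^ (- q))%R by exact: powR_gt0.
have [] := exists_weak_splitting R w be kap _ mw w0 (@conj_exponent R p q hq hqp) kap01 tau0.
  move=> E F mE mF Efin Ffin.
  have -> : \int[(leb \x leb)]_(z in E `*` F) w z =
     ((N^-1) `^ q)%:E * \int[(leb \x leb)]_(z in E `*` F) (`|a z| `^ q)%:E.
    have mEF : measurable (E `*` F) by exact: measurableX.
    rewrite -ge0_integralZl_EFin ?powR_ge0//; last first.
      exact: measurable_funS (measurable_norm_powR _ q _ ma).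
    apply: eq_integral => z _.
    by rewrite /w -EFinM -powRM ?invr_ge0 ?(ltW N0)// mulrC.
  have := rectangle_le_tnorm a u E F ma u0; rewrite au => /(_ (lexx _) mE mF Efin Ffin) h.
  have Nq0 : 0 <= ((N^-1) `^ q)%:E by rewrite lee_fin powR_ge0.
  apply: (le_trans (lee_wpmul2l Nq0 h)).
  by rewrite -EFinM mulrA -powRM ?invr_ge0 ?(ltW N0)// [(N^-1 * u)%R]mulrC.
move=> A [mA Al Ar].
have mcA : measurable (~` A) by exact: measurableC.
pose b1 : RL R * RL R -> R := (a \* \1_A)%R.
pose c1 : RL R * RL R -> R := (a \* \1_(~` A))%R.
have mwB B : measurable B -> measurable_fun setT (w \_ B).
  move=> mB; apply/(measurable_restrictT w) => //; exact: measurable_funS mw.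
have wB0 B z : 0 <= (w \_ B) z by rewrite patchE; case: ifP.
have b1N : normA0 p q b1 <= N%:E.
  rewrite normA0E; apply: weakLnorm_root_le => //.
    by move=> x; apply: integral_ge0 => y _; rewrite lee_fin powR_ge0.
  move=> v v0; apply: le_trans (Al _ v0).
  rewrite le_eqVlt; apply/orP; left; apply/eqP; congr (leb _).
  have hb x : \int[leb]_y (`|b1 (x, y)| `^ q)%:E = (N `^ q)%:E * \int[leb]_y (w \_ A) (x, y).
    rewrite -ge0_integralZl_EFin ?powR_ge0//; last first.
      exact: measurableT_comp (mwB _ mA) (measurable_pair1 x).
    by apply: eq_integral => y _; exact: norm_indic_powR.
  by apply/seteqP; split => x /=; rewrite hb EFinM lte_pmul2l// lte_fin powR_gt0.
have c1N : normA1 p q c1 <= (N / t)%:E.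
  rewrite normA1E; apply: weakLnorm_root_le => //.
  - by move=> x; apply: integral_ge0 => y _; rewrite lee_fin powR_ge0.
  - by rewrite divr_gt0.
  move=> v v0; apply: le_trans (Ar _ v0).
  rewrite le_eqVlt; apply/orP; left; apply/eqP; congr (leb _).
  (* The choice [tau = t^(-q)] matches the norm [N / t] of the second piece. *)
  have -> : ((N / t) `^ q * v `^ (be - 1) = N `^ q * (t `^ (- q) * v `^ (be - 1)))%R.
    rewrite powRM ?invr_ge0 ?(ltW N0) ?(ltW t0)// -powR_inv1 ?(ltW t0)// -powRrM mulN1r.
    by rewrite mulrA.
  have hc y : \int[leb]_x (`|c1 (x, y)| `^ q)%:E =
      (N `^ q)%:E * \int[leb]_x (w \_ (~` A)) (x, y).
    rewrite -ge0_integralZl_EFin ?powR_ge0//; last first.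
      exact: measurableT_comp (mwB _ mcA) (measurable_pair2 y).
    by apply: eq_integral => x _; exact: norm_indic_powR.
  by apply/seteqP; split => y /=; rewrite hc [((N `^ q)%R * _)%:E]EFinM lte_pmul2l// lte_fin powR_gt0.
apply: (@le_trans _ _ (normA0 p q b1 + t%:E * normA1 p q c1)).
  apply: ereal_inf_lbound; exists (b1, c1) => //=; split.
    by apply: measurable_funM => //; exact: measurable_indic.
  split; first by apply: measurable_funM => //; exact: measurable_indic.
  apply/funext => z /=; rewrite -mulrDr !indicE in_setC.
  by case: (z \in A); rewrite /= ?addr0 ?add0r mulr1.
have te0 : 0 <= t%:E by rewrite lee_fin ltW.
apply: (le_trans (leeD b1N (lee_wpmul2l te0 c1N))).
rewrite -EFinM -EFinD lee_fin [(t * _)%R]mulrC divfK ?gt_eqF//.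
by rewrite mulrDl mul1r.
Qed.

End UpperBound.

Theorem theorem3p1 (R : realType) (p : \bar R) (q : R)
    (hq : 1 <= q) (hqp : (q%:E < p)%E) (t : R) (ht : 0 < t)
    (a : RL R * RL R -> R) (ha : inA0A1 p q a) :
  ((Cpq p q)%:E * tnorm p q t a <= Kfun p q t a)%E /\
  (Kfun p q t a <= 2%:E * tnorm p q t a)%E.
Proof.
split; first exact: Cpq_tnorm_le_Kfun.
have ma : measurable_fun setT a.
  by case: ha => b [c [mb mc -> _ _]]; exact: measurable_funD.
have n0 := tnorm_ge0 R p q t a.
case au: (tnorm p q t a) n0 => [u| |]// n0; last by rewrite gt0_muley ?leey// lte_fin.
apply/lee_addgt0Pr => e e0.
(* [e / 2], since the factor [2] in [Kfun_le_double] doubles the excess. *)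
have aN : (tnorm p q t a < (u + e / 2)%:E)%E by rewrite au lte_fin ltrDl divr_gt0.
apply: le_trans (Kfun_le_double R p q t hq hqp ht a _ ma aN) _.
by rewrite -EFinM -EFinD lee_fin mulrDr [2 * (e / 2)]mulrC divfK.
Qed.
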